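(* Let $\Gamma_p$, $p\in\mathcal P$, be the family of parametric games described in the context, with feasible sets $X(p)$ and pseudo-gradient $F(x,p)$. Suppose that the following three assumptions hold. (A1) For each $p\in\mathcal P$ the game $\Gamma_p$ is jointly convex and admits a variational generalized Nash equilibrium (v-GNE) $x^\star(p)$. Moreover, $F(x,p)$ is (jointly) continuous in $x$ and $p$, and there is a constant $\nu>0$, independent of $p$, such that $$\langle F(x,p),\,x-x^\star(p)\rangle\ \ge\ \nu\,\|x-x^\star(p)\|^2\qquad\text{for all }x\in X(p),\ p\in\mathcal P .$$ (A2) For any fixed $p\in\mathcal P$ there exist constants $\delta>0$ and $c_p>0$ such that for all $q\in\mathcal P\cap B_\delta(p)$ $$\bigl\|x^\star(q)-\Pi_{X(p)}(x^\star(q))\bigr\|\le c_p\,\|p-q\| .$$ (A3) For any fixed $y\in\mathbb R^{n_x}$ the mapping $p\mapsto \Pi_{X(p)}(y)$ is continuous over $\mathcal P$. Then there exists a continuous parametric v-GNE solution map for the games $\Gamma_p$, $p\in\mathcal P$; that is, there is a continuous map $p\mapsto x^\star(p)$ from $\mathcal P$ to $\mathbb R^{n_x}$ such that $x^\star(p)$ is a v-GNE of $\Gamma_p$ for every $p\in\mathcal P$.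
   Context: Setting. There are $N$ agents; agent $i$ has decision variable $x_i\in\mathbb R^{n_i}$, $\sum_{i=1}^N n_i=n_x$, and $x=(x_1,\dots,x_N)=(x_i,x_{-i})\in\mathbb R^{n_x}$ is the joint decision vector. The parameter is $p\in\mathcal P\subseteq\mathbb R^{n_p}$. Agent $i$ has cost function $J_i(x_i,x_{-i},p)$, $J_i:\mathbb R^{n_x}\times\mathbb R^{n_p}\to\mathbb R$. All agents share the constraints $g(x,p)\le 0$ (componentwise) and $h(x,p)=0$, with $g:\mathbb R^{n_x}\times\mathbb R^{n_p}\to\mathbb R^{n_g}$ and $h:\mathbb R^{n_x}\times\mathbb R^{n_p}\to\mathbb R^{n_h}$, and $$X(p)=\{x\in\mathbb R^{n_x}:\ g(x,p)\le 0,\ h(x,p)=0\}.$$ The game $\Gamma_p=\Gamma(N,\{J_i(\cdot,p)\},X(p))$ is the one in which each agent $i$ minimizes $J_i(x_i,x_{-i},p)$ over $x_i$ subject to $(x_i,x_{-i})\in X(p)$. Jointly convex. $\Gamma_p$ is jointly convex if the shared coupling constraints are convex (each component of $g(\cdot,p)$ is convex in $x$ and $h(\cdot,p)$ is affine in $x$, so $X(p)$ is a closed convex set) and each $J_i$ is convex and differentiable in $x_i$ for any fixed $x_{-i}$ and $p$. Pseudo-gradient. $F(x,p)=\left[\frac{\partial J_1(x,p)}{\partial x_1},\ldots,\frac{\partial J_N(x,p)}{\partial x_N}\right]^\top\in\mathbb R^{n_x}$. v-GNE. A variational generalized Nash equilibrium of $\Gamma_p$ is a solution of the variational inequality $VI(F(\cdot,p),X(p))$,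 i.e. a point $x^\star\in X(p)$ with $\langle F(x^\star,p),x-x^\star\rangle\ge 0$ for all $x\in X(p)$. Notation. $\|\cdot\|$ and $\langle\cdot,\cdot\rangle$ are the Euclidean norm and inner product, $B_\delta(p)$ is the ball of radius $\delta$ centered at $p$, and $\Pi_{X(p)}$ is the Euclidean projection onto $X(p)$. Under (A1) the v-GNE $x^\star(p)$ is unique for each $p$, and $x^\star(\cdot)$ in (A2) refers to it. *)

(* Defs.v *)
From HB Require Import structures.
From mathcomp Require Import all_boot all_order all_algebra.
From mathcomp Require Import all_classical all_reals all_analysis.
Set Implicit Arguments.
Unset Strict Implicit.
Unset Printing Implicit Defensive.
Import Order.TTheory GRing.Theory Num.Theory.
Import numFieldNormedType.Exports.
Local Open Scope classical_set_scope.
Local Open Scope ring_scope.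

(* The norm `|u| that MathComp-Analysis puts on 'rV[R]_n is the sup norm. It
   induces the usual topology (used for continuity and differentiability), but
   the metric statements below are about the Euclidean norm. *)
Definition inner (R : realType) (n : nat) (u v : 'rV[R]_n) : R :=
  \sum_(i < n) u 0 i * v 0 i.

Definition enorm (R : realType) (n : nat) (u : 'rV[R]_n) : R :=
  Num.sqrt (inner u u).

(* Euclidean projection onto A: a nearest point of A to y (unique when A is
   nonempty, closed and convex); the default 0 is taken when A has no point
   nearest to y. *)
Definition eproj (R : realType) (n : nat) (A : set 'rV[R]_n) (y : 'rV[R]_n) :
    'rV[R]_n :=
  xget 0 [set z | A z /\ forall w, A w -> enorm (y - z) <= enorm (y - w)].

(* Solutions of the variational inequality VI(F, A). *)
Definition VI_sol (R : realType) (n : nat) (F : 'rV[R]_n -> 'rV[R]_n)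
    (A : set 'rV[R]_n) : set 'rV[R]_n :=
  [set x | A x /\ forall y, A y -> 0 <= inner (F x) (y - x)].

Definition gradient (R : realType) (n : nat) (f : 'rV[R]_n -> R)
    (x : 'rV[R]_n) : 'rV[R]_n :=
  \row_(j < n) 'D_(delta_mx 0 j) f x.

Definition affine (R : realType) (m n : nat) (f : 'rV[R]_m -> 'rV[R]_n) :=
  exists (A : 'M[R]_(m, n)) (b : 'rV[R]_n), forall x, f x = x *m A + b.

(* Data of the family of games; dim i is the dimension of the decision x_i of
   agent i, and the joint decision is the concatenation of the x_i. *)
Record pgame (R : realType) (N : nat) (dim : 'I_N -> nat) (np ng nh : nat) :=
  PGame {
    cost : 'I_N -> 'rV[R]_(\sum_i dim i) -> 'rV[R]_np -> R ;
    ineq : 'rV[R]_(\sum_i dim i) -> 'rV[R]_np -> 'rV[R]_ng ;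
    eqcon : 'rV[R]_(\sum_i dim i) -> 'rV[R]_np -> 'rV[R]_nh }.

(* The joint vector (y, x_{-i}). *)
Definition deviate (R : realType) (N : nat) (dim : 'I_N -> nat)
    (x : 'rV[R]_(\sum_i dim i)) (i : 'I_N) (y : 'rV[R]_(dim i)) :
    'rV[R]_(\sum_i dim i) :=
  \mxrow_(j < N) eqtype.dfwith (fun k => submxrow x k) y j.

Section Game.
Variables (R : realType) (N : nat) (dim : 'I_N -> nat) (np ng nh : nat).
Variable G : pgame R dim np ng nh.
Implicit Types (x : 'rV[R]_(\sum_i dim i)) (p : 'rV[R]_np).

Definition feasible p : set 'rV[R]_(\sum_i dim i) :=
  [set x | (forall k, ineq G x p 0 k <= 0) /\ eqcon G x p = 0].

Definition own_cost (i : 'I_N) x p (y : 'rV[R]_(dim i)) : R :=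
  cost G i (deviate x y) p.

Definition jointly_convex p :=
  [/\ forall k, convex_function setT (fun x => ineq G x p 0 k),
      affine (fun x => eqcon G x p) &
      forall (i : 'I_N) x,
        convex_function setT (own_cost (i := i) x p) /\
        forall y, differentiable (own_cost (i := i) x p) y].

Definition pseudo_gradient x p : 'rV[R]_(\sum_i dim i) :=
  \mxrow_(i < N) gradient (own_cost (i := i) x p) (submxrow x i).

Definition vGNE p : set 'rV[R]_(\sum_i dim i) :=
  VI_sol (fun x => pseudo_gradient x p) (feasible p).

End Game.

(* Main.v *)
Require Import Defs.
From HB Require Import structures.
From mathcomp Require Import all_boot all_order all_algebra.
From mathcomp Require Import all_classical all_reals all_analysis.
From mathcomp Require Import lra ring.
Set Implicit Arguments.
Unset Strict Implicit.
Unset Printing Implicit Defensive.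
Import Order.TTheory GRing.Theory Num.Theory.
Import numFieldNormedType.Exports.
Local Open Scope classical_set_scope.
Local Open Scope ring_scope.

(** The equilibrium map [xstar] that the hypotheses provide is itself
    continuous; the proof is a stability estimate for strongly monotone
    variational inequalities.  Write X(q) for the feasible set, F for the
    pseudo-gradient and fix a parameter p.  For q near p compare xstar q with
    z = the projection of xstar p on X(q) and y = the projection of xstar q on
    X(p).  Strong monotonicity at q, used at the feasible point z of X(q), gives
      nu |z - xstar q|^2 <= <F(z,q), z - xstar q>,
    while the variational inequality at p, used at the feasible point y of
    X(p), gives 0 <= <F(xstar p,p), y - xstar p>.  Splitting
      z - xstar q = (z - xstar p) - (y - xstar p) - (xstar q - y)
    in the part of the inner product against F(xstar p,p) yields
    ([VI_sol_dist_le])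
      nu |z - xstar q|^2 <= a |z - xstar q| + b,
    where a is a multiple of |F(z,q) - F(xstar p,p)| and b is a multiple of
    |z - xstar p| + |xstar q - y|.  As q tends to p, the projection z tends to
    the projection of xstar p on X(p), which is xstar p; continuity of F at
    (xstar p, p) makes a tend to 0, and the Lipschitz bound on |xstar q - y|
    makes b tend to 0.  A quadratic inequality of this shape forces
    z - xstar q to tend to 0 ([cvg0_quadratic_bound]), hence xstar q tends to
    xstar p ([VI_sol_cvg]).

    The argument evaluates the hypotheses at projections, so these have to be
    genuine points of the feasible sets.  This holds because a feasible set is
    closed ([closed_feasible]): a finite convex function on R^n is bounded above
    near each point by its value plus a multiple of the distance, which makes
    its sublevel sets closed ([closed_convex_sublevel]), and an affine equation
    is a pair of convex inequalities per coordinate.  A closed nonempty set has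
    nearest points ([eproj_in]).

    Euclidean quantities are compared with the sup norm throughout, at the cost
    of factors equal to the dimension, which are harmless for limits. *)

(** * Euclidean norm and sup norm *)

Section Euclid.
Context {R : realType} {n : nat}.
Implicit Types u v w : 'rV[R]_n.

Lemma entry_le_norm u i : `|u 0 i| <= `|u|.
Proof.
rewrite [leRHS]/Num.norm /= mx_normrE; apply/bigmax_geP.
by right => /=; exists (0, i).
Qed.

Lemma innerDr u v w : inner u (v + w) = inner u v + inner u w.
Proof.
by rewrite /inner -big_split; apply: eq_bigr => i _; rewrite mxE mulrDr.
Qed.

Lemma innerBl u v w : inner (u - v) w = inner u w - inner v w.
Proof.
by rewrite /inner -sumrB; apply: eq_bigr => i _; rewrite !mxE mulrBl.
Qed.

(** A crude form of Cauchy-Schwarz, with the sup norm on the right: it keeps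
    every later estimate within the norm that defines the topology. *)
Lemma normr_inner_le u v : `|inner u v| <= n%:R * `|u| * `|v|.
Proof.
apply: le_trans (ler_norm_sum _ _ _) _.
rewrite -mulrA mulr_natl -[n in _ *+ n]card_ord -sumr_const.
by apply: ler_sum => i _; rewrite normrM ler_pM ?entry_le_norm.
Qed.

Lemma norm_le_enorm u : `|u| <= enorm u.
Proof.
rewrite {1}/Num.norm /= mx_normrE; apply/bigmax_leP; split=> [|[i j] _] /=.
  exact: sqrtr_ge0.
rewrite -sqrtr_sqr ler_wsqrtr // /inner (bigD1 j) //= ord1 expr2 lerDl.
by apply: sumr_ge0 => k _; rewrite -expr2 sqr_ge0.
Qed.

Lemma enorm_le_norm u : enorm u <= n%:R * `|u|.
Proof.
rewrite -[leRHS]ger0_norm ?mulr_ge0 // -sqrtr_sqr ler_wsqrtr //.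
apply: le_trans (ler_norm _) _; apply: le_trans (normr_inner_le _ _) _.
rewrite exprMn -mulrA -expr2 ler_wpM2r ?sqr_ge0 // expr2 -natrM ler_nat.
by case: (n) => // k; rewrite leq_pmulr.
Qed.

Lemma enorm_continuous : continuous (@enorm R n).
Proof.
have inner_cont : continuous (fun u : 'rV[R]_n => inner u u).
  apply: continuous_big => [|i _ u]; first exact: add_continuous.
  have cvg_entry : {for u, continuous (fun v : 'rV[R]_n => v 0 i)}.
    exact: coord_continuous.
  exact: (cvgM cvg_entry cvg_entry).
move=> u; apply: continuous_comp; first exact: inner_cont.
exact: sqrt_continuous.
Qed.

End Euclid.

(** * Convex constraints define closed sets *)

Section ConvexBound.
Context {R : realType}.

Lemma convex_comb_le (E : lmodType R) (f : E -> R) (t : R) (x y : E) :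
  convex_function setT f -> 0 <= t <= 1 ->
  f (t *: x + (1 - t) *: y) <= t * f x + (1 - t) * f y.
Proof.
move=> cf /andP[t0 t1].
by have := cf (Itv01 t0 t1) x y; rewrite !inE => /(_ Logic.I Logic.I).
Qed.

(** On the segment between [x] and [x + v], or [x] and [x - v], a convex function
    stays below its chord; [C] dominates the slopes of both chords. *)
Lemma convex_line_bound (E : lmodType R) (f : E -> R) (x v : E) :
  convex_function setT f ->
  exists2 C, 0 <= C & forall t, `|t| <= 1 -> f (x + t *: v) <= f x + C * `|t|.
Proof.
move=> cf; exists (`|f (x + v) - f x| + `|f (x - v) - f x|) => [|t].
  exact: addr_ge0.
have line (w : E) (s : R) : 0 <= s <= 1 ->
    f (x + s *: w) <= f x + `|f (x + w) - f x| * s.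
  move=> s01; have -> : x + s *: w = s *: (x + w) + (1 - s) *: x.
    by rewrite scalerDr scalerBl scale1r [RHS]addrC addrA subrK.
  apply: le_trans (convex_comb_le _ _ cf s01) _.
  have := ler_norm (f (x + w) - f x); move/andP: s01 => [s0 _]; nra.
have [t0 t1|t0 t1] := leP 0 t.
  rewrite ger0_norm // in t1 *.
  apply: le_trans (line _ _ _) _; first by rewrite t0.
  by rewrite lerD2l ler_wpM2r // lerDl.
rewrite ltr0_norm // in t1 *.
have -> : t *: v = (- t) *: (- v) by rewrite scalerN scaleNr opprK.
apply: le_trans (line _ _ _) _; first by rewrite t1 oppr_ge0 ltW.
by rewrite lerD2l ler_wpM2r ?lerDr ?oppr_ge0 ?(ltW t0).
Qed.

(** Directions are added one at a time: [x + (a + b)] is the midpoint of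
    [x + 2 a] and [x + 2 b], so the bounds along [a] and along [b] combine, at
    the cost of halving the radius on which they are valid. *)
Lemma convex_span_bound (E : lmodType R) (f : E -> R) (x : E) (I : Type)
    (s : seq I) (v : I -> E) :
  convex_function setT f ->
  exists C r : R, [/\ 0 <= C, 0 < r & forall (e : R) (t : I -> R), e <= r ->
    (forall i, `|t i| <= e) ->
    f (x + \sum_(i <- s) t i *: v i) <= f x + C * e].
Proof.
move=> cf; elim: s => [|i s [C [r [C0 r0 IH]]]].
  exists 0, 1; split=> // e t _ te; by rewrite big_nil addr0 mul0r addr0.
have [D D0 HD] := @convex_line_bound E f x (v i) cf.
exists (C + D), (Num.min (r / 2) (1 / 2)); split=> [||e t].
- exact: addr_ge0.
- by rewrite lt_min; apply/andP; split; lra.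
rewrite le_min => /andP[er e1] te; rewrite big_cons.
set S := \sum_(_ <- _) _.
have half : 0 <= (2^-1 : R) <= 1 by apply/andP; split; lra.
have -> : x + (t i *: v i + S) = 2^-1 *: (x + (2 * t i) *: v i) +
    (1 - 2^-1) *: (x + \sum_(j <- s) (2 * t j) *: v j).
  have -> : 1 - 2^-1 = 2^-1 :> R by lra.
  rewrite -scalerDr; under eq_bigr do rewrite -scalerA.
  rewrite -scaler_sumr -/S -scalerA addrACA -scalerDr.
  rewrite -mulr2n -(scaler_nat 2 x) -scalerDr scalerA mulVf ?scale1r //.
apply: le_trans (convex_comb_le _ _ cf half) _.
have n2 j : `|2 * t j| = 2 * `|t j| by rewrite normrM ger0_norm.
have := HD (2 * t i); have := IH (2 * e) (fun j => 2 * t j).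
have := te i; rewrite n2 => tei IH' HD'.
have {}IH' := IH' ltac:(lra) (fun j => ltac:(by rewrite n2; have := te j; lra)).
have {}HD' := HD' ltac:(lra).
nra.
Qed.

Lemma convex_locally_bounded n (f : 'rV[R]_n -> R) (x : 'rV[R]_n) :
  convex_function setT f ->
  exists C r : R, [/\ 0 <= C, 0 < r &
    forall h, `|h| <= r -> f (x + h) <= f x + C * `|h|].
Proof.
move=> cf.
have [C [r [C0 r0 H]]] := @convex_span_bound _ f x _ (index_enum 'I_n)
  (fun i => 'e_i) cf.
exists C, r; split=> // h hr; rewrite {1}(row_sum_delta h).
by apply: H => // i; exact: entry_le_norm.
Qed.

(** If [w] in the sublevel set is close to [z], then [z] is the midpoint of [w]
    and of its reflection [z + (z - w)], so [f z <= (f (z + (z - w)) + f w) / 2].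
    The local upper bound at [z] controls the value at the reflection, and
    [f z <= C * `|z - w|] follows. *)
Lemma closed_convex_sublevel n (f : 'rV[R]_n -> R) :
  convex_function setT f -> closed [set x | f x <= 0].
Proof.
move=> cf z /= zcl.
have [C [r [C0 r0 H]]] := convex_locally_bounded z cf.
apply/ler_addgt0Pr => e e0; rewrite add0r.
(* [C + 1] instead of [C] keeps the denominator positive when [C = 0] *)
pose d := Num.min r (e / (C + 1)).
have d0 : 0 < d by rewrite lt_min r0 divr_gt0 //; lra.
have [w [/= fw]] := zcl _ (nbhsx_ballx z d d0).
rewrite -ball_normE /= => zw.
have {}zw : `|z - w| < d by [].
have := H (z - w); rewrite (le_trans (ltW zw)) ?ge_min ?lexx // => /(_ isT) fzw.
have half : 0 <= (2^-1 : R) <= 1 by apply/andP; split; lra.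
have := convex_comb_le (z + (z - w)) w cf half.
have -> : 2^-1 *: (z + (z - w)) + (1 - 2^-1) *: w = z.
  have -> : 1 - 2^-1 = 2^-1 :> R by lra.
  by rewrite -scalerDr -addrA subrK -mulr2n -(scaler_nat 2 z) scalerA mulVf ?scale1r.
have : C * `|z - w| <= e.
  have : `|z - w| <= e / (C + 1) by rewrite (le_trans (ltW zw)) // ge_min lexx orbT.
  rewrite ler_pdivlMr; last by lra.
  have := normr_ge0 (z - w); nra.
lra.
Qed.

Lemma closed_affine_kernel m n (f : 'rV[R]_m -> 'rV[R]_n) :
  affine f -> closed [set x | f x = 0].
Proof.
move=> [A [b fE]].
have conv (c : R) j : convex_function setT (fun x => c * f x 0 j).
  move=> t x y _ _; rewrite convRE !fE.
  rewrite (_ : conv t x y = t%:num *: x + (1 - t%:num) *: y) //.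
  rewrite mulmxDl -!scalemxAl !mxE le_eqVlt; apply/orP; left; apply/eqP.
  by rewrite /= /unstable.onem; ring.
have -> : [set x | f x = 0] =
    \bigcap_(j in setT)
      ([set x | 1 * f x 0 j <= 0] `&` [set x | -1 * f x 0 j <= 0]).
  apply/seteqP; split=> x /=.
    by move=> fx j _ /=; rewrite fx mxE !mulr0.
  move=> H; apply/rowP => j; have [/=] := H j Logic.I.
  by rewrite mul1r mulN1r oppr_le0 mxE => a c; apply/eqP; rewrite eq_le a c.
apply: closed_bigI => j _; apply: closedI; exact: closed_convex_sublevel.
Qed.

End ConvexBound.

(** * Projection on a closed set *)

Section Projection.
Context {R : realType} {n : nat}.
Implicit Types (A : set 'rV[R]_n) (x y : 'rV[R]_n).

(** Minimizing the distance to [y] over [A] amounts to minimizing it over the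
    points of [A] that are at least as close as a given [a] of [A], and these
    form a compact set. *)
Lemma eproj_in A y : closed A -> A !=set0 -> A (eproj A y).
Proof.
move=> Acl [a Aa]; rewrite /eproj; case: xgetP => [z _ [] //|none].
pose B := A `&` [set w | enorm (y - w) <= enorm (y - a)].
have dist_cont : continuous (fun w : 'rV[R]_n => enorm (y - w)).
  move=> w; apply: continuous_comp; last exact: enorm_continuous.
  apply: continuousB; [exact: cst_continuous | exact: cvg_id].
have Bcl : closed B.
  apply: closedI => //.
  apply: (@preimage_closed _ _ (fun w : 'rV[R]_n => enorm (y - w))
    [set t | t <= enorm (y - a)]).
    by move=> w _; exact: dist_cont.
  exact: closed_le.
have Bbd : bounded_set B.
  exists (`|y| + enorm (y - a)); split; first exact: num_real.
  move=> M /ltW yM w [_ /= wy]; apply: le_trans yM; apply: le_trans (_ : `|y| + `|y - w| <= _).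
    by rewrite -[w in leLHS](subKr y) ler_normB.
  rewrite lerD2l.
  exact: le_trans (norm_le_enorm _) wy.
have [|z] := EVT_min_rV _ (bounded_closed_compact Bbd Bcl)
  (continuous_subspaceT dist_cont); first by exists a; split => /=.
rewrite inE => -[Az za] zmin; exfalso; apply: (none z); split=> // w Aw.
have [wa|/ltW wa] := leP (enorm (y - w)) (enorm (y - a)).
  by apply: zmin; rewrite inE; split.
exact: le_trans za wa.
Qed.

Lemma eproj_id A x : A x -> eproj A x = x.
Proof.
have e0 : enorm (x - x) = 0.
  apply/eqP; rewrite eq_le sqrtr_ge0 andbT (le_trans (enorm_le_norm _)) //.
  by rewrite subrr normr0 mulr0.
move=> Ax; rewrite /eproj; case: xgetP => [z _ [Az /(_ x Ax)]|/(_ x)[]].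
  rewrite e0 => /(le_trans (norm_le_enorm _)).
  by rewrite normr_le0 subr_eq0 => /eqP.
by split=> // w _; rewrite e0 sqrtr_ge0.
Qed.

End Projection.

(** * Stability of strongly monotone variational inequalities *)

Section Stability.
Context {R : realType} {m n : nat}.
Implicit Types (A : set 'rV[R]_n) (F : 'rV[R]_n -> 'rV[R]_m -> 'rV[R]_n).

(** Comparison of the solution [xA] of the inequality for [F] on [A] with a
    point [xB] relative to which [G] is strongly monotone at [z].  In the
    application [xB] solves the inequality for [G] on a second set containing
    [z], and [z], [y] approximate [xA], [xB] within the other's set. *)
Lemma VI_sol_dist_le (F G : 'rV[R]_n -> 'rV[R]_n) A (xA xB y z : 'rV[R]_n) nu :
  VI_sol F A xA -> A y ->
  nu * enorm (z - xB) ^+ 2 <= inner (G z) (z - xB) -> 0 < nu ->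
  nu * `|z - xB| ^+ 2 <= n%:R * `|G z - F xA| * `|z - xB|
    + n%:R * `|F xA| * (`|z - xA| + `|xB - y|).
Proof.
move=> [_ VIA] Ay mono nu0.
have d2 : nu * `|z - xB| ^+ 2 <= nu * enorm (z - xB) ^+ 2.
  by rewrite ler_pM2l // ler_sqr ?nnegrE ?sqrtr_ge0 // norm_le_enorm.
apply: (le_trans d2); apply: (le_trans mono).
have -> : inner (G z) (z - xB) = inner (G z - F xA) (z - xB)
    + inner (F xA) (z - xA) - inner (F xA) (y - xA) - inner (F xA) (xB - y).
  have split : z - xA = (z - xB) + ((xB - y) + (y - xA)).
    by rewrite !addrA !subrK.
  rewrite split innerBl !innerDr; ring.
have h1 := normr_inner_le (G z - F xA) (z - xB).
have h2 := normr_inner_le (F xA) (z - xA).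
have h3 := normr_inner_le (F xA) (xB - y).
have h4 := VIA _ Ay.
have := ler_norm (inner (G z - F xA) (z - xB)).
have := ler_norm (inner (F xA) (z - xA)).
have := ler_norm (- inner (F xA) (xB - y)); rewrite normrN.
lra.
Qed.

Lemma cvg0_dist (T : Type) (V : normedModType R) (D : set_system T)
    (f : T -> V) (l : V) :
  Filter D -> f x @[x --> D] --> l -> `|f x - l| @[x --> D] --> 0.
Proof.
move=> FD fl; rewrite -(normr0 V) -(subrr l).
exact: (cvg_norm (cvgB fl (cvg_cst l))).
Qed.

Lemma cvg0_scale (T : Type) (D : set_system T) (f : T -> R) (c : R) :
  Filter D -> f x @[x --> D] --> 0 -> c * f x @[x --> D] --> 0.
Proof.
move=> FD f0; rewrite -[X in _ --> X](mulr0 c).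
exact: cvgMl_tmp.
Qed.

(** Once [a x < nu e / 2] and [b x < nu e^2 / 4], the quadratic inequality is
    incompatible with [e <= d x]: its right-hand side is then at most three
    quarters of [nu * d x ^+ 2]. *)
Lemma cvg0_quadratic_bound (T : Type) (D : set_system T) (a b d : T -> R) nu :
  Filter D -> 0 < nu -> a x @[x --> D] --> 0 -> b x @[x --> D] --> 0 ->
  (forall x, 0 <= d x) ->
  (\forall x \near D, nu * d x ^+ 2 <= a x * d x + b x) ->
  d x @[x --> D] --> 0.
Proof.
move=> FD nu0 a0 b0 d0 bound; apply/cvgrPdist_lt => e e0.
have ea : 0 < nu * e / 2 by rewrite !(divr_gt0, mulr_gt0).
have eb : 0 < nu * e ^+ 2 / 4 by rewrite !(divr_gt0, mulr_gt0, exprn_gt0).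
move/cvgrPdist_lt/(_ _ ea) : a0 => a0; move/cvgrPdist_lt/(_ _ eb) : b0 => b0.
near=> x.
have bx : nu * d x ^+ 2 <= a x * d x + b x by near: x.
have ax : a x < nu * e / 2.
  by rewrite (le_lt_trans (ler_norm _)) // -normrN -sub0r; near: x.
have bxe : b x < nu * e ^+ 2 / 4.
  by rewrite (le_lt_trans (ler_norm _)) // -normrN -sub0r; near: x.
rewrite sub0r normrN ger0_norm //; have := d0 x.
set t := d x in bx *; move=> t0; rewrite ltNge; apply/negP => et.
have : a x * t <= nu * e / 2 * t by rewrite ler_wpM2r // ltW.
have : nu * e * t <= nu * t ^+ 2.
  by rewrite expr2 mulrA ler_wpM2r // ler_wpM2l // ltW.
have : nu * e ^+ 2 <= nu * t ^+ 2.
  by rewrite ler_wpM2l ?(ltW nu0) // ler_sqr ?nnegrE // ltW.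
have : 0 < nu * e ^+ 2 by rewrite mulr_gt0 // exprn_gt0.
lra.
Unshelve. all: by end_near. Qed.

(** [VI_sol_dist_le] compares [F^~ p] on [X p] with [F^~ q] on [X q]: the
    projection of [xs p] on [X q] tends to [xs p] because [xs p] is its own
    projection on [X p], and the distance from [xs q] to [X p] is at most of
    order [`|q - p|]. *)
Lemma VI_sol_cvg F (X : 'rV[R]_m -> set 'rV[R]_n) (P : set 'rV[R]_m)
    (xs : 'rV[R]_m -> 'rV[R]_n) (nu : R) (p : 'rV[R]_m) :
  P p -> (forall q, P q -> closed (X q)) ->
  (forall q, P q -> VI_sol (F^~ q) (X q) (xs q)) ->
  F x.1 x.2 @[x --> within [set x | P x.2] (nbhs (xs p, p))] --> F (xs p) p ->
  0 < nu ->
  (forall q, P q -> forall x, X q x ->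
     nu * enorm (x - xs q) ^+ 2 <= inner (F x q) (x - xs q)) ->
  (exists delta c : R, [/\ 0 < delta, 0 < c &
     forall q, P q -> enorm (q - p) < delta ->
       enorm (xs q - eproj (X p) (xs q)) <= c * enorm (p - q)]) ->
  eproj (X q) (xs p) @[q --> within P (nbhs p)] --> eproj (X p) (xs p) ->
  xs q @[q --> within P (nbhs p)] --> xs p.
Proof.
move=> Pp Xcl sol Fcvg nu0 mono [delta [c [delta0 c0 lip]]] projcvg.
have Xxs q : P q -> X q (xs q) by case/sol.
pose z q := eproj (X q) (xs p).
pose y q := eproj (X p) (xs q).
have Xz q : P q -> X q (z q).
  by move=> Pq; apply: eproj_in; [exact: Xcl|exists (xs q); exact: Xxs].
have Xy q : X p (y q).
  by apply: eproj_in; [exact: Xcl|exists (xs p); exact: Xxs].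
have zcvg : z q @[q --> within P (nbhs p)] --> xs p.
  by rewrite -[X in _ --> X](eproj_id (Xxs _ Pp)).
have qcvg : q @[q --> within P (nbhs p)] --> p by exact: cvg_within.
have nearP : within P (nbhs p) P by rewrite /within /=; near=> q.
have zqcvg : (z q, q) @[q --> within P (nbhs p)] -->
    within [set x : 'rV[R]_n * 'rV[R]_m | P x.2] (nbhs (xs p, p)).
  move=> S hS.
  have {}hS : within P (nbhs p) [set q | P q -> S (z q, q)].
    exact: (cvg_pair zcvg qcvg hS).
  by apply: (filterS2 _ _ nearP hS) => q Pq; apply.
have Gcvg : F (z q) q @[q --> within P (nbhs p)] --> F (xs p) p.
  exact: (cvg_comp _ _ zqcvg Fcvg).
have pqcvg : m%:R * `|q - p| @[q --> within P (nbhs p)] --> (0 : R).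
  by apply: cvg0_scale; exact: cvg0_dist.
have ycvg : `|xs q - y q| @[q --> within P (nbhs p)] --> (0 : R).
  have lipcvg : c * (m%:R * `|q - p|) @[q --> within P (nbhs p)] --> (0 : R).
    exact: cvg0_scale.
  apply: squeeze_cvgr lipcvg; last exact: cvg_cst.
  near=> q; rewrite normr_ge0 /=.
  have Pq : P q by near: q.
  have qp : enorm (q - p) < delta.
    apply: le_lt_trans (enorm_le_norm _) _.
    by near: q; exact: cvgr_lt pqcvg _ delta0.
  apply: le_trans (norm_le_enorm _) _; apply: le_trans (lip q Pq qp) _.
  by rewrite ler_pM2l // -(distrC p) enorm_le_norm.
have dcvg : `|z q - xs q| @[q --> within P (nbhs p)] --> (0 : R).
  apply: (@cvg0_quadratic_bound _ _
    (fun q => n%:R * `|F (z q) q - F (xs p) p|)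
    (fun q => n%:R * `|F (xs p) p| * (`|z q - xs p| + `|xs q - y q|)) _ nu) => //.
  - by apply: cvg0_scale; exact: cvg0_dist.
  - apply: cvg0_scale; rewrite -[X in _ --> X](addr0 0).
    exact: (cvgD (cvg0_dist _ zcvg) ycvg).
  - near=> q; have Pq : P q by near: q.
    have mono_q := mono q Pq _ (Xz q Pq).
    exact: (VI_sol_dist_le (F := F^~ p) (G := F^~ q) (sol p Pp) (Xy q)
      mono_q nu0).
have {}dcvg : z q - xs q @[q --> within P (nbhs p)] --> (0 : 'rV[R]_n).
  by apply/norm_cvg0P.
have : z q - (z q - xs q) @[q --> within P (nbhs p)] --> xs p.
  by rewrite -[X in _ --> X]subr0; exact: (cvgB zcvg dcvg).
by under eq_cvg do rewrite subKr.
Unshelve. all: by end_near. Qed.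

End Stability.

(** * The parametric game *)

Lemma closed_feasible (R : realType) (N : nat) (dim : 'I_N -> nat)
    (np ng nh : nat) (G : pgame R dim np ng nh) (p : 'rV[R]_np) :
  jointly_convex G p -> closed (feasible G p).
Proof.
move=> [ineq_convex eqcon_affine _].
have -> : feasible G p = \bigcap_(k in setT) [set x | ineq G x p 0 k <= 0]
    `&` [set x | eqcon G x p = 0].
  apply/seteqP; split=> x [] xineq xeq; split=> // k; last exact: xineq.
  by move=> _; exact: xineq.
apply: closedI; last exact: closed_affine_kernel.
by apply: closed_bigI => k _; exact: closed_convex_sublevel.
Qed.

Theorem proposition4p2 (R : realType) (N : nat) (dim : 'I_N -> nat)
  (np ng nh : nat) (G : pgame R dim np ng nh) (P : set 'rV[R]_np)
  (xstar : 'rV[R]_np -> 'rV[R]_(\sum_i dim i)) (nu : R)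
  (G_convex : forall p, P p -> jointly_convex G p)
  (xstar_vGNE : forall p, P p -> vGNE G p (xstar p))
  (F_continuous : {within [set xp | P xp.2], continuous
     (fun xp : 'rV[R]_(\sum_i dim i) * 'rV[R]_np =>
        pseudo_gradient G xp.1 xp.2)})
  (nu_gt0 : 0 < nu)
  (F_monotone : forall p, P p -> forall x, feasible G p x ->
     nu * enorm (x - xstar p) ^+ 2
       <= inner (pseudo_gradient G x p) (x - xstar p))
  (xstar_proj : forall p, P p -> exists delta c : R,
     [/\ 0 < delta, 0 < c &
       forall q, P q -> enorm (q - p) < delta ->
         enorm (xstar q - eproj (feasible G p) (xstar q)) <= c * enorm (p - q)])
  (proj_continuous : forall y : 'rV[R]_(\sum_i dim i),
     {within P, continuous (fun p => eproj (feasible G p) y)}) :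
  exists sol : 'rV[R]_np -> 'rV[R]_(\sum_i dim i),
    {within P, continuous sol} /\ forall p, P p -> vGNE G p (sol p).
Proof.
exists xstar; split => //; apply/subspace_continuousP => p Pp.
apply: (@VI_sol_cvg _ _ _ (fun x p => pseudo_gradient G x p) (feasible G) P
  xstar nu) => //.
- by move=> q Pq; exact: closed_feasible (G_convex q Pq).
- by move/subspace_continuousP: F_continuous => /(_ (xstar p, p)); exact.
- exact: xstar_proj.
- by move/subspace_continuousP: (proj_continuous (xstar p)) => /(_ p Pp).
Qed.
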